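(* Let $G$ be a $d$-regular $n$-vertex graph with girth $\omega(l)$, where $l$ is an integer with $l\in[32 r_G,\mathcal{O}(\gamma_G)]$ and $\gamma_G=\sqrt{\log_d n/r_G}$. Then with probability $1-n^{-\Omega(1)}$, the maximum load after $n$ balls have been allocated by the generic algorithm $\mathcal{A}(G,l)$ is at least $\Omega\!\left(\frac{\log_d n}{r_G\cdot l^2}\right)$.
   Context: Define $r_G=1$ if $d=\omega(\log n)$ and $r_G=\lceil 2\log_{d-1}\log n\rceil$ otherwise. The vertices of $G$ are bins; the load of a vertex is the number of balls on it. A non-backtracking random walk (NBRW) of length $L$ from a vertex is a walk of $L$ steps in which at each step the walker moves to a uniformly random neighbour of its current vertex, never traversing the same edge twice in a row. The generic algorithm $\mathcal{A}(G,l)$: for $t=1,\dots,n$, ball $t$ picks a vertex uniformly at random, performs an NBRW of length $l\cdot r_G$ from it, visiting $(u_0,\dots,u_{l r_G})$, and is placed on a vertex of minimum current load among $\{u_{j r_G}:0\le j\le l\}$ (ties broken at random). Asymptotics are as $n\to\infty$. *)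

(* Defs.v *)
From HB Require Import structures.
From mathcomp Require Import all_boot all_order all_algebra.
From mathcomp Require Import all_classical all_reals all_analysis.

Set Implicit Arguments.
Unset Strict Implicit.
Unset Printing Implicit Defensive.

Import Order.TTheory GRing.Theory Num.Theory.
Import numFieldNormedType.Exports.

Local Open Scope classical_set_scope.
Local Open Scope ring_scope.

Record sgraph := SGraph {
  vertex :> finType;
  edge : rel vertex;
  edge_sym : symmetric edge;
  edge_irrefl : irreflexive edge
}.

Definition neighbours (G : sgraph) (x : G) : {set G} := [set y | edge x y]%SET.

Definition regular (G : sgraph) (d : nat) : Prop :=
  forall x : G, #|neighbours x| = d.

Definition has_cycle (G : sgraph) (k : nat) : bool :=
  (2 < k)%N && [exists c : k.-tuple G, ucycleb (@edge G) c].

(* The length of a shortest cycle; 0 if there is none, which cannot happen in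
   a nonempty graph of minimum degree at least 2. *)
Definition girth (G : sgraph) : nat :=
  head 0%N [seq k <- iota 0 #|G|.+1 | has_cycle G k].

Section Allocation.
Variables (R : realType) (G : sgraph) (l r : nat).

Definition uniform_law (T : finType) (A : {set T}) (x : T) : R :=
  (x \in A)%:R / #|A|%:R.

(* The vertices to which a walker at x may move when the vertex visited just
   before x was prev (None if x is the starting vertex).  As G is simple, not
   traversing the same edge twice in a row means not returning to prev. *)
Definition nb_next (prev : option G) (x : G) : {set G} :=
  [set y in neighbours x | Some y != prev]%SET.

Fixpoint nbrw_from (prev : option G) (x : G) (s : seq G) : R :=
  if s is y :: s' then uniform_law (nb_next prev x) y * nbrw_from (Some x) y s'
  else 1.

Definition nbrw_law (w : seq G) : R :=
  if w is x :: s then uniform_law [set: G]%SET x * nbrw_from None x s else 0.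

Definition walk : finType := ((l * r).+1.-tuple G)%type.

Definition probes (w : walk) : {set G} :=
  [set tnth w (inord (j * r)) | j : 'I_l.+1]%SET.

Definition least_loaded (load : G -> nat) (A : {set G}) : {set G} :=
  [set v in A | [forall u in A, (load v <= load u)%N]]%SET.

(* The probability that the next balls, starting from the given loads, perform
   the walks and are placed on the vertices listed (in this order) in s. *)
Fixpoint alloc_from (load : G -> nat) (s : seq (walk * G)) : R :=
  if s is (w, v) :: s' then
    nbrw_law w * uniform_law (least_loaded load (probes w)) v
      * alloc_from (fun u => load u + (u == v))%N s'
  else 1.

(* One (walk, destination) pair for each of the n = #|G| balls. *)
Definition outcome : finType := (#|G|.-tuple (walk * G))%type.

Definition alloc_law (o : outcome) : R := alloc_from (fun=> 0%N) o.

Definition alloc_prob (E : pred outcome) : R := \sum_(o | E o) alloc_law o.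

Definition final_load (o : outcome) (v : G) : nat :=
  count (fun b => b.2 == v) o.

Definition max_load (o : outcome) : nat := (\max_(v : G) final_load o v)%N.

End Allocation.

Definition log_base (R : realType) (b x : R) : R := ln x / ln b.

Section Asymptotics.
Variables (R : realType) (G : nat -> sgraph) (d : nat -> nat).

(* The case distinction defining r_G is a property of the whole sequence, so
   r_G is defined for a sequence of graphs.  When d >= 3 and G k is nonempty,
   #|G k| >= 4 and the argument of the ceiling is positive, so that taking the
   absolute value of the integer only changes its type. *)
Definition r_G (k : nat) : nat :=
  if `[< (fun i => ln #|G i|%:R : R) =o_\oo (fun i => (d i)%:R : R) >] then 1%N
  else `|Num.ceil (2 * log_base (d k).-1%:R (ln #|G k|%:R : R))|%N.

Definition gamma_G (k : nat) : R :=
  Num.sqrt (log_base (d k)%:R #|G k|%:R / (r_G k)%:R).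

End Asymptotics.

(* Main.v *)
Require Import Defs.
From HB Require Import structures.
From mathcomp Require Import all_boot all_order all_algebra.
From mathcomp Require Import all_classical all_reals all_analysis.
From mathcomp Require Import ring lra zify.

Set Implicit Arguments.
Unset Strict Implicit.
Unset Printing Implicit Defensive.

Import Order.TTheory GRing.Theory Num.Theory.
Import numFieldNormedType.Exports.

Local Open Scope classical_set_scope.
Local Open Scope ring_scope.

(** Write n for the number of vertices and r for r_G.  The walks of the balls
    are independent and identically distributed, and a walk of positive
    probability has probability between 1 / (n d^(l r)) and 1 / n.  Let m be the
    integer part of log_d n / (8 l r).  If some walk is performed by m balls,
    these balls lie on its at most l + 1 probes, so some load is at least
    m / (l + 1).  To see that such a walk exists, split the balls into m blocks
    and let Y be the number of walks performed in every block.  Its indicators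
    are pairwise negatively correlated, so P(Y = 0) <= 1 / E Y, where
    E Y >= n (4 m d^(l r))^(-m).  As r_G is chosen so that ln n <= d^r, this is
    at least n^(3/4).  If m = 0, it suffices that the maximum load is at least 1. *)

(** * Expectations over independent, identically distributed samples *)

Section IidExpectation.
Variables (R : realFieldType) (W : finType) (p : W -> R).

(** Samples are lists rather than tuples, so that blocks of a sample are obtained with [take] and
    [drop], without casts between tuple types. *)
Fixpoint iidE (n : nat) (f : seq W -> R) : R :=
  if n is n'.+1 then \sum_w p w * iidE n' (fun s => f (w :: s)) else f [::].

Lemma eq_iidE n f g :
  (forall s, size s = n -> f s = g s) -> iidE n f = iidE n g.
Proof.
elim: n f g => [|n IH] f g fg /=; first exact: fg.
by apply: eq_bigr => w _; congr (_ * _); apply: IH => s sn; apply: fg; rewrite /= sn.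
Qed.

Lemma iidED n f g : iidE n (fun s => f s + g s) = iidE n f + iidE n g.
Proof.
elim: n f g => [|n IH] f g //=; rewrite -big_split /=.
by apply: eq_bigr => w _; rewrite IH mulrDr.
Qed.

Lemma iidEZ n c f : iidE n (fun s => c * f s) = c * iidE n f.
Proof.
elim: n f => [|n IH] f //=; rewrite mulr_sumr.
by apply: eq_bigr => w _; rewrite IH mulrCA.
Qed.

Lemma iidE_sum (I : Type) (r : seq I) n (f : I -> seq W -> R) :
  iidE n (fun s => \sum_(i <- r) f i s) = \sum_(i <- r) iidE n (f i).
Proof.
elim: r => [|i r IH].
  rewrite big_nil; transitivity (iidE n (fun=> 0 * 0)); last by rewrite iidEZ mul0r.
  by apply: eq_iidE => s _; rewrite big_nil mul0r.
rewrite big_cons -IH -iidED; apply: eq_iidE => s _; exact: big_cons.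
Qed.

Lemma iidE_cat a b f :
  iidE (a + b) f = iidE a (fun s => iidE b (fun t => f (s ++ t))).
Proof.
by elim: a f => [|a IH] f //=; apply: eq_bigr => w _; rewrite IH.
Qed.

(** This is the independence of two disjoint blocks of the sample. *)
Lemma iidE_take_drop a b f g :
  iidE (a + b) (fun s => f (take a s) * g (drop a s)) = iidE a f * iidE b g.
Proof.
rewrite iidE_cat mulrC -iidEZ; apply: eq_iidE => s sa.
rewrite mulrC -iidEZ; apply: eq_iidE => t _.
by rewrite take_size_cat ?drop_size_cat.
Qed.

Hypothesis p_ge0 : forall w, 0 <= p w.

Lemma le_iidE n f g :
  (forall s, size s = n -> f s <= g s) -> iidE n f <= iidE n g.
Proof.
elim: n f g => [|n IH] f g fg /=; first exact: fg.
apply: ler_sum => w _; apply: ler_wpM2l => //.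
by apply: IH => s sn; apply: fg; rewrite /= sn.
Qed.

Hypothesis p_sum1 : \sum_w p w = 1.

Lemma iidE_cst n c : iidE n (fun=> c) = c.
Proof. by elim: n => [|n IH] //=; rewrite IH -mulr_suml p_sum1 mul1r. Qed.

Lemma iidE_all n (h : pred W) :
  iidE n (fun s => (all h s)%:R) = (\sum_(w | h w) p w) ^+ n.
Proof.
elim: n => [|n IH] //=; rewrite exprS -IH mulr_suml [RHS]big_mkcond /=.
apply: eq_bigr => w _; case: (h w) => //=.
by rewrite iidE_cst mulr0.
Qed.

Lemma sum_predC1 w : \sum_(v | v != w) p v = 1 - p w.
Proof. by apply/eqP; rewrite eq_sym subr_eq -p_sum1 (bigD1 w) //= addrC. Qed.

Lemma sum_predC2 w v : w != v ->
  \sum_(u | (u != w) && (u != v)) p u = 1 - p w - p v.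
Proof.
move=> wv; rewrite -sum_predC1 [in RHS](bigD1 v) ?(eq_sym v) //=.
by rewrite addrAC subrr add0r.
Qed.

Lemma p_le1 w : p w <= 1.
Proof. by rewrite -subr_ge0 -sum_predC1 sumr_ge0. Qed.

(** * Blocks of samples that contain a given value *)

Definition hit_prob b w := 1 - (1 - p w) ^+ b.

Lemma all_predC1 (w : W) s : all (fun v => v != w) s = (w \notin s).
Proof. by rewrite -has_pred1 -all_predC. Qed.

Lemma natr_negb (c : bool) : c%:R = 1 - (~~ c)%:R :> R.
Proof. by case: c; rewrite /= ?subr0 ?subrr. Qed.

Lemma iidE_hit b w : iidE b (fun s => (w \in s)%:R) = hit_prob b w.
Proof.
rewrite (@eq_iidE _ _ (fun s => 1 + -1 * (all (fun v => v != w) s)%:R)); last first.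
  by move=> s _; rewrite all_predC1 mulN1r -natr_negb.
by rewrite iidED iidE_cst iidEZ iidE_all sum_predC1 mulN1r.
Qed.

(** Negative correlation. By inclusion-exclusion the two sides differ only in one term, which is
    [(1 - p w - p v) ^+ b] on the left and [((1 - p w) * (1 - p v)) ^+ b] on the right. *)
Lemma iidE_hit2 b w v : w != v ->
  iidE b (fun s => (w \in s)%:R * (v \in s)%:R) <= hit_prob b w * hit_prob b v.
Proof.
move=> wv; pose h u := (u != w) && (u != v).
rewrite (@eq_iidE _ _ (fun s => (w \in s)%:R +
   ((v \in s)%:R + (-1 + (all h s)%:R)))); last first.
  move=> s _; rewrite /h all_predI !all_predC1.
  by case: (w \in s); case: (v \in s); rewrite /=; ring.
rewrite !iidED !iidE_hit iidE_cst iidE_all sum_predC2 // /hit_prob.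
have h1 : 0 <= 1 - p w - p v by rewrite -sum_predC2 // sumr_ge0.
have h2 : 1 - p w - p v <= (1 - p w) * (1 - p v).
  by have := mulr_ge0 (p_ge0 w) (p_ge0 v); lra.
have := lerXn2r b h1 (le_trans h1 h2) h2.
rewrite exprMn; lra.
Qed.

(** A stand-in for the event that [w] occurs at least [m] times. Since the blocks are independent,
    its probability is exactly a power of [hit_prob], and the negative correlation within one block
    carries over to all of them. *)
Fixpoint block_hit b m (w : W) (s : seq W) : bool :=
  if m is m'.+1 then (w \in take b s) && block_hit b m' w (drop b s) else true.

Lemma block_hit_count b m w s : block_hit b m w s -> (m <= count_mem w s)%N.
Proof.
elim: m s => [|m IH] s //= /andP[]; rewrite -has_pred1 has_count => w1 /IH h.
by rewrite -(cat_take_drop b s) count_cat -addn1 addnC leq_add.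
Qed.

Lemma iidE_block_hit b m w :
  iidE (m * b) (fun s => (block_hit b m w s)%:R) = hit_prob b w ^+ m.
Proof.
elim: m => [|m IH] //.
rewrite mulSn exprS -IH -iidE_hit -iidE_take_drop.
by apply: eq_iidE => s _ /=; rewrite -mulnb natrM.
Qed.

Lemma hit_prob_ge0 b w : 0 <= hit_prob b w.
Proof.
by rewrite subr_ge0 exprn_ile1 ?subr_ge0 ?p_le1 // lerBlDr lerDl.
Qed.

Lemma iidE_block_hit2 b m w v : w != v ->
  iidE (m * b) (fun s => (block_hit b m w s)%:R * (block_hit b m v s)%:R)
    <= hit_prob b w ^+ m * hit_prob b v ^+ m.
Proof.
move=> wv; elim: m => [|m IH]; first by rewrite /= mulr1.
rewrite mulSn (@eq_iidE _ _ (fun s =>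
    ((w \in take b s)%:R * (v \in take b s)%:R)
  * ((block_hit b m w (drop b s))%:R * (block_hit b m v (drop b s))%:R))); last first.
  by move=> s _ /=; rewrite -!mulnb !natrM mulrACA.
rewrite (iidE_take_drop _ _ (fun s => (w \in s)%:R * (v \in s)%:R)
  (fun s => (block_hit b m w s)%:R * (block_hit b m v s)%:R)).
rewrite !exprS mulrACA; apply: ler_pM => //; last exact: iidE_hit2.
  by rewrite -(iidE_cst b 0); apply: le_iidE => s _; rewrite mulr_ge0.
by rewrite -(iidE_cst (m * b) 0); apply: le_iidE => s _; rewrite mulr_ge0.
Qed.

(* Chebyshev's inequality: the indicators [block_hit b m w] are pairwise
   negatively correlated, so the variance of their sum is at most its mean. *)
Lemma no_block_hit_prob b m (mu := \sum_w hit_prob b w ^+ m) : 0 < mu ->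
  iidE (m * b) (fun s => (~~ [exists w, block_hit b m w s])%:R) <= mu^-1.
Proof.
move=> mu0; pose Y s : R := \sum_w (block_hit b m w s)%:R.
have EY : iidE (m * b) Y = mu.
  by rewrite iidE_sum; apply: eq_bigr => w _; rewrite iidE_block_hit.
have EY2 : iidE (m * b) (fun s => Y s ^+ 2) <= mu + mu ^+ 2.
  rewrite (@eq_iidE _ _ (fun s => \sum_w \sum_v
     ((block_hit b m w s)%:R * (block_hit b m v s)%:R))); last first.
    move=> s _; rewrite expr2 mulr_suml; apply: eq_bigr => w _.
    by rewrite mulr_sumr.
  rewrite iidE_sum expr2 [X in _ + X]mulr_suml -big_split /=.
  apply: ler_sum => w _; rewrite iidE_sum mulr_sumr.
  (* The diagonal pair contributes its mean, an indicator being its own square; all other pairs are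
     bounded by negative correlation. *)
  rewrite (bigD1 w) //= [X in _ <= _ + X](bigD1 w) //= addrA.
  apply: lerD; last by apply: ler_sum => v vw; rewrite iidE_block_hit2 // eq_sym.
  rewrite (@eq_iidE _ _ (fun s => (block_hit b m w s)%:R)); last first.
    by move=> s _; rewrite -natrM mulnb andbb.
  by rewrite iidE_block_hit lerDl mulr_ge0 // exprn_ge0 // hit_prob_ge0.
pose Z s : R := (~~ [exists w, block_hit b m w s])%:R.
(* The right side is the square of [Y s - mu], which equals [mu ^+ 2] when no block event occurs.
   Its expectation is the variance of [Y], at most [mu]. *)
have ZY s : mu ^+ 2 * Z s <= Y s ^+ 2 + (- (2 * mu) * Y s + mu ^+ 2).
  rewrite /Z; case: existsP => [_|nh] /=.
    rewrite mulr0; have := sqr_ge0 (Y s - mu); rewrite !expr2; lra.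
  suff -> : Y s = 0 by rewrite !mulr0 expr0n /= mulr1 !add0r.
  by apply: big1 => w _; case: block_hit (introN idP (fun h => nh (ex_intro _ w h))).
have := @le_iidE (m * b) _ _ (fun s _ => ZY s).
rewrite iidEZ !iidED iidEZ iidE_cst EY => h.
rewrite -(ler_pM2l (exprn_gt0 2 mu0)) expr2 -[leRHS]mulrA mulfV ?gt_eqF // mulr1 -expr2.
by apply: (le_trans h); move: EY2; rewrite !expr2; lra.
Qed.

(** With x = b p(w), induction on b gives (1 - p(w))^b (1 + x) <= 1. Hence the hit probability is at
    least x / (1 + x), which is at least x / 2 as x <= 1. *)
Lemma hit_prob_ge b w : b%:R * p w <= 1 -> b%:R * p w / 2 <= hit_prob b w.
Proof.
move=> bp; rewrite /hit_prob.
have : (1 - p w) ^+ b * (1 + b%:R * p w) <= 1.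
  elim: b {bp} => [|b IH]; first by rewrite mul0r addr0 mulr1.
  apply: le_trans IH; rewrite exprSr -mulrA ler_wpM2l //.
    by rewrite exprn_ge0 // subr_ge0 p_le1.
  have := mulr_ge0 (ler0n R b.+1) (mulr_ge0 (p_ge0 w) (p_ge0 w)).
  by rewrite -natr1; lra.
set q := _ ^+ b; set x := _ * p w in bp * => h.
have x0 : 0 <= x by rewrite mulr_ge0.
have q0 : 0 <= q by rewrite exprn_ge0 // subr_ge0 p_le1.
by nra.
Qed.

(** One of the [m.+1] factors is bounded in terms of [p w] itself, and these bounds add up because
    [p] sums to 1; only the other [m] factors are bounded through [delta]. The support of [p] thus
    need not be counted. *)
Lemma sum_hit_prob_ge b m (delta : R) : 0 <= delta ->
  (forall w, p w != 0 -> delta <= p w) -> (forall w, b%:R * p w <= 1) ->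
  b%:R / 2 * (b%:R * delta / 2) ^+ m <= \sum_w hit_prob b w ^+ m.+1.
Proof.
move=> delta0 p_ge bp.
rewrite -[leLHS]mul1r -[X in X * _]p_sum1 mulr_suml; apply: ler_sum => w _.
have [->|pw] := eqVneq (p w) 0; first by rewrite mul0r exprn_ge0 // hit_prob_ge0.
rewrite mulrA (_ : p w * (b%:R / 2) = b%:R * p w / 2); last by ring.
rewrite exprS ler_pM ?hit_prob_ge //.
- by rewrite mulr_ge0 ?invr_ge0 // mulr_ge0.
- by rewrite exprn_ge0 // mulr_ge0 ?invr_ge0 // mulr_ge0.
have h : b%:R * delta / 2 <= hit_prob b w.
  apply: le_trans (hit_prob_ge (bp w)).
  by rewrite ler_pM2r ?invr_gt0 // ler_wpM2l // p_ge.
by apply: lerXn2r; rewrite ?nnegrE ?hit_prob_ge0 // mulr_ge0 ?invr_ge0 // mulr_ge0.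
Qed.

End IidExpectation.

(** * Sums over tuples *)

Lemma sum_tupleS (R : nmodType) (T : finType) n (F : seq T -> R) :
  \sum_(t : n.+1.-tuple T) F t = \sum_x \sum_(t : n.-tuple T) F (x :: t).
Proof.
rewrite pair_big /=.
rewrite (reindex (fun xt : T * n.-tuple T => [tuple of xt.1 :: xt.2])) //=.
exists (fun t => (thead t, [tuple of behead t])) => [[x t] _|t _] /=.
  by congr (_, _); apply: val_inj.
by rewrite [RHS]tuple_eta; apply: val_inj.
Qed.

Lemma sum_tuple0 (R : nmodType) (T : finType) (F : seq T -> R) :
  \sum_(t : 0.-tuple T) F t = F [::].
Proof.
rewrite (big_pred1 [tuple]) // => t /=.
by apply/esym/eqP; rewrite [LHS]tuple0.
Qed.

(** * Uniform distributions on finite sets *)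

Section UniformLaw.
Variables (R : realType) (T : finType) (A : {set T}).

Lemma uniform_law_ge0 x : 0 <= uniform_law R A x.
Proof. by rewrite divr_ge0. Qed.

Lemma uniform_law_neq0 x : uniform_law R A x != 0 -> x \in A.
Proof. by rewrite /uniform_law; case: (x \in A) => //; rewrite mul0r eqxx. Qed.

Lemma sum_uniform_law : A != finset.set0 -> \sum_x uniform_law R A x = 1.
Proof.
move=> A0; rewrite -mulr_suml -natr_sum.
have -> : (\sum_x (x \in A) = #|A|)%N by rewrite -sum1_card [RHS]big_mkcond.
by rewrite divff // pnatr_eq0 cards_eq0.
Qed.

Lemma uniform_law_le x : uniform_law R A x <= #|A|%:R^-1.
Proof.
by rewrite /uniform_law; case: (x \in A); rewrite ?mul1r // mul0r invr_ge0.
Qed.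

Lemma uniform_law_ge k x : (#|A| <= k)%N -> uniform_law R A x != 0 ->
  k%:R^-1 <= uniform_law R A x.
Proof.
move=> Ak /uniform_law_neq0 xA; rewrite /uniform_law xA mul1r.
have A0 : (0 < #|A|)%N by apply/card_gt0P; exists x.
by rewrite lef_pV2 ?ler_nat // posrE ltr0n // (leq_trans A0).
Qed.

Lemma uniform_law_le1 x : uniform_law R A x <= 1.
Proof.
apply: le_trans (uniform_law_le x) _.
by case: #|A| => [|k]; rewrite ?invr0 ?ler01 // invf_le1 // ler1n.
Qed.

End UniformLaw.

(** * The law of the non-backtracking walk *)

Section WalkLaw.
Variables (R : realType) (G : sgraph) (d : nat).
Hypotheses (G_regular : regular G d) (d_gt1 : (1 < d)%N).
Implicit Types (prev : option G) (x : G) (s : seq G).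

Lemma card_nb_next_le prev x : (#|nb_next prev x| <= d)%N.
Proof.
by rewrite -(G_regular x) subset_leq_card //; apply/fintype.subsetP => y; rewrite inE => /andP[].
Qed.

(** With degree at least 2, excluding the previous vertex never strands the walker, so the law of
    each step has total mass 1. *)
Lemma nb_next_neq0 prev x : nb_next prev x != finset.set0.
Proof.
rewrite -card_gt0; case: prev => [z|]; last first.
  rewrite (_ : nb_next _ _ = neighbours x) ?G_regular ?(ltnW d_gt1) //.
  by apply/finset.setP => y; rewrite inE andbT.
rewrite (_ : nb_next _ _ = (neighbours x :\ z)%SET); last first.
  by apply/finset.setP => y; rewrite !inE andbC.
have := cardsD1 z (neighbours x); rewrite G_regular; move: d_gt1.
by case: (z \in _) => /=; lia.
Qed.

Lemma nbrw_from_ge0 prev x s : 0 <= nbrw_from R prev x s.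
Proof.
by elim: s prev x => [|y s IH] prev x //=; rewrite mulr_ge0 // uniform_law_ge0.
Qed.

Lemma nbrw_from_le1 prev x s : nbrw_from R prev x s <= 1.
Proof.
elim: s prev x => [|y s IH] prev x //=.
by rewrite mulr_ile1 ?uniform_law_ge0 ?uniform_law_le1 ?nbrw_from_ge0.
Qed.

Lemma nbrw_from_ge prev x s : nbrw_from R prev x s != 0 ->
  d%:R^-1 ^+ size s <= nbrw_from R prev x s.
Proof.
elim: s prev x => [|y s IH] prev x //=.
rewrite mulf_eq0 negb_or => /andP[u0 /IH h]; rewrite exprS ler_pM ?exprn_ge0 ?invr_ge0 //.
by rewrite uniform_law_ge // card_nb_next_le.
Qed.

Lemma sum_nbrw_from n prev x : \sum_(t : n.-tuple G) nbrw_from R prev x t = 1.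
Proof.
elim: n prev x => [|n IH] prev x; first by rewrite sum_tuple0.
rewrite sum_tupleS -[RHS](sum_uniform_law R (nb_next_neq0 prev x)).
by apply: eq_bigr => y _; rewrite /= -mulr_sumr IH mulr1.
Qed.

Lemma nbrw_law_ge0 s : 0 <= nbrw_law R s.
Proof. by case: s => //= x s; rewrite mulr_ge0 ?uniform_law_ge0 ?nbrw_from_ge0. Qed.

Lemma nbrw_law_le s : nbrw_law R s <= #|G|%:R^-1.
Proof.
case: s => [|x s] /=; first by rewrite invr_ge0.
rewrite -cardsT -[leRHS]mulr1 ler_pM ?uniform_law_ge0 ?nbrw_from_ge0 ?nbrw_from_le1 //.
exact: uniform_law_le.
Qed.

Lemma nbrw_law_ge n (t : n.+1.-tuple G) : nbrw_law R t != 0 ->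
  (#|G|%:R * d%:R ^+ n)^-1 <= nbrw_law R t.
Proof.
case: t => [[|x s] //= sz]; rewrite mulf_eq0 negb_or => /andP[u0 v0].
rewrite invfM -exprVn ler_pM ?exprn_ge0 ?invr_ge0 //.
  by rewrite uniform_law_ge // cardsT.
by have := nbrw_from_ge v0; rewrite (eqP (sz : size s == n)).
Qed.

Lemma sum_nbrw_law n : (0 < #|G|)%N -> \sum_(t : n.+1.-tuple G) nbrw_law R t = 1.
Proof.
move=> G0; rewrite sum_tupleS -[RHS](@sum_uniform_law R G [set: G]%SET).
  by apply: eq_bigr => y _; rewrite /= -mulr_sumr sum_nbrw_from mulr1.
by rewrite -card_gt0 cardsT.
Qed.

End WalkLaw.

(** * The law of the allocation process *)

Section AllocationLaw.
Variables (R : realType) (G : sgraph) (l r : nat).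
Implicit Types load : G -> nat.

Let p (w : walk G l r) : R := nbrw_law R w.

Lemma probes_neq0 (w : walk G l r) : probes w != finset.set0.
Proof. by apply/finset.set0Pn; exists (tnth w (inord (0 * r))); apply/imsetP; exists ord0. Qed.

Lemma card_probes (w : walk G l r) : (#|probes w| <= l.+1)%N.
Proof. by rewrite (leq_trans (leq_imset_card _ _)) // card_ord. Qed.

Lemma least_loaded_neq0 load (A : {set G}) : A != finset.set0 -> least_loaded load A != finset.set0.
Proof.
case/finset.set0Pn => x xA; apply/finset.set0Pn.
case: (arg_minnP load xA) => v vA vmin.
by exists v; rewrite inE; apply/andP; split => //; apply/forall_inP.
Qed.

(** A destination depends on the current loads, but its conditional law has mass 1 whatever they
    are. Summing the destinations out therefore leaves independent walks. *)
Lemma alloc_from_walks n load (F : seq (walk G l r) -> R) :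
  \sum_(t : n.-tuple (walk G l r * G)) alloc_from R load t * F (map fst t)
    = iidE p n F.
Proof.
elim: n load F => [|n IH] load F.
  by rewrite (sum_tuple0 (fun s => alloc_from R load s * F (map fst s))) /= mul1r.
rewrite (sum_tupleS n (fun s => alloc_from R load s * F (map fst s))) /=.
transitivity (\sum_w \sum_v \sum_(t : n.-tuple (walk G l r * G))
  alloc_from R load ((w, v) :: t) * F (map fst ((w, v) :: t))).
  by rewrite [RHS]pair_bigA; apply: eq_bigr => -[w v] _.
apply: eq_bigr => w _.
transitivity (\sum_v uniform_law R (least_loaded load (probes w)) v *
   (p w * iidE p n (fun s => F (w :: s)))); last first.
  by rewrite -mulr_suml sum_uniform_law ?mul1r // least_loaded_neq0 ?probes_neq0.
apply: eq_bigr => v _.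
rewrite -(IH (fun u => load u + (u == v))%N) !mulr_sumr.
by apply: eq_bigr => t _; rewrite -/(p w) !mulrA; congr (_ * _ * _); rewrite mulrC.
Qed.

Lemma alloc_from_ge0 load (s : seq (walk G l r * G)) : 0 <= alloc_from R load s.
Proof.
elim: s load => [|[w v] s IH] load //=.
by rewrite !mulr_ge0 ?nbrw_law_ge0 ?uniform_law_ge0.
Qed.

Lemma alloc_from_neq0 load (s : seq (walk G l r * G)) :
  alloc_from R load s != 0 -> all (fun b => b.2 \in probes b.1) s.
Proof.
elim: s load => [|[w v] s IH] load //=.
rewrite mulf_eq0 negb_or => /andP[+ /IH ->]; rewrite mulf_eq0 negb_or.
case/andP => _ /uniform_law_neq0.
by rewrite inE => /andP[->].
Qed.

(** Every ball that performs [w] adds 1 to the load of one of the probes of [w]. *)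
Lemma count_walk_le_load (w : walk G l r) (s : seq (walk G l r * G)) :
  all (fun b => b.2 \in probes b.1) s ->
  (count_mem w (map fst s) <= \sum_(v in probes w) count (fun b => b.2 == v) s)%N.
Proof.
elim: s => [|[w' v] s IH] /=; first by [].
case/andP => v_in /IH {}IH; rewrite big_split /= leq_add //.
have [ww|//] := eqVneq w' w.
by rewrite (bigD1 v) ?eqxx //= -ww.
Qed.

Lemma count_walk_le_max_load (o : outcome G l r) (w : walk G l r) :
  alloc_law R o != 0 -> (count_mem w (map fst o) <= l.+1 * max_load o)%N.
Proof.
move=> /alloc_from_neq0 /(count_walk_le_load w) /leq_trans; apply.
apply: (@leq_trans (\sum_(v in probes w) max_load o)%N).
  by apply: leq_sum => v _; exact: leq_bigmax.
by rewrite sum_nat_const leq_mul2r card_probes orbT.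
Qed.

Lemma max_load_gt0 (o : outcome G l r) : (0 < #|G|)%N -> (0 < max_load o)%N.
Proof.
(* There are as many balls as vertices, so [G0] also provides a ball. *)
move=> G0; pose b := tnth o (Ordinal G0).
apply: (@leq_trans (final_load o b.2)); last exact: leq_bigmax.
by rewrite -has_count; apply/hasP; exists b; rewrite ?mem_tnth /=.
Qed.

Lemma le_alloc_prob (E E' : pred (outcome G l r)) :
  (forall o, alloc_law R o != 0 -> E o -> E' o) -> alloc_prob R E <= alloc_prob R E'.
Proof.
move=> EE'; rewrite /alloc_prob big_mkcond [leRHS]big_mkcond; apply: ler_sum => o _.
have [->|/EE' {}EE'] := eqVneq (alloc_law R o) 0; first by do 2 case: ifP.
case: ifP => [/EE' -> //|_].
by case: ifP => // _; apply: alloc_from_ge0.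
Qed.

Lemma alloc_prob_walks (E : pred (seq (walk G l r))) :
  alloc_prob R (fun o : outcome G l r => E (map fst o)) =
  iidE p #|G| (fun s => (E s)%:R).
Proof.
rewrite -(alloc_from_walks _ (fun=> 0%N)) /alloc_prob big_mkcond.
by apply: eq_bigr => o _ /=; case: (E _); rewrite ?mulr1 ?mulr0.
Qed.

Variable d : nat.
Hypotheses (G_regular : regular G d) (d_gt1 : (1 < d)%N) (G_gt0 : (0 < #|G|)%N).

Lemma alloc_probT : alloc_prob R (fun _ : outcome G l r => true) = 1.
Proof.
rewrite (alloc_prob_walks xpredT) iidE_cst //.
exact: (sum_nbrw_law R G_regular d_gt1).
Qed.

Lemma alloc_prob_repeated_walk b m (mu := \sum_w hit_prob p b w ^+ m) :
  0 < mu -> (m * b <= #|G|)%N ->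
  1 - mu^-1 <= alloc_prob R (fun o : outcome G l r => (m <= l.+1 * max_load o)%N).
Proof.
move=> mu0 mb.
have p0 w : 0 <= p w := nbrw_law_ge0 R w.
have p1 : \sum_w p w = 1 := sum_nbrw_law R G_regular d_gt1 _ G_gt0.
(* Only the first [m * b] balls are split into blocks; the others can only increase the count of a
   walk. *)
pose E (s : seq (walk G l r)) := [exists w, block_hit b m w (take (m * b) s)].
apply: (@le_trans _ _ (alloc_prob R (fun o : outcome G l r => E (map fst o)))); last first.
  apply: le_alloc_prob => o o0 /existsP[w /block_hit_count hw].
  apply: leq_trans hw (leq_trans _ (count_walk_le_max_load w o0)).
  by rewrite -[X in (_ <= count_mem _ X)%N](cat_take_drop (m * b)) count_cat leq_addr.
rewrite alloc_prob_walks -(subnKC mb) iidE_cat.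
pose Z (s : seq (walk G l r)) : R := (~~ [exists w, block_hit b m w s])%:R.
rewrite (@eq_iidE _ _ _ _ _ (fun s => 1 + -1 * Z s)); last first.
  move=> s sz; rewrite -{1}[RHS](iidE_cst p1 (#|G| - m * b)); apply: eq_iidE => t _.
  by rewrite /E take_size_cat // mulN1r -natr_negb.
by rewrite iidED iidE_cst // iidEZ mulN1r lerD2l lerN2; apply: no_block_hit_prob.
Qed.

(** The blocks have size b = floor(n / m). The inequality b p(w) <= 1 holds since walks have
    probability at most 1 / n, and [delta] is the least possible positive probability 1 / (n d^(l
    r)). *)
Lemma alloc_prob_max_load m : (0 < m <= #|G|)%N ->
  1 - (4 * m%:R * d%:R ^+ (l * r)) ^+ m / #|G|%:R
    <= alloc_prob R (fun o : outcome G l r => (m <= l.+1 * max_load o)%N).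
Proof.
case: m => // m /= mn; set n := #|G|; pose b := (n %/ m.+1)%N.
have p1 : \sum_w p w = 1 := sum_nbrw_law R G_regular d_gt1 _ G_gt0.
pose D : R := d%:R ^+ (l * r).
have D1 : 1 <= D by rewrite exprn_ege1 // ler1n ltnW.
have n0 : 0 < n%:R :> R by rewrite ltr0n.
have m0 : 0 < m.+1%:R :> R by [].
have D0 : 0 < D by apply: lt_le_trans D1.
have bn : b%:R <= n%:R :> R by rewrite ler_nat leq_div.
(* As b is at least 1, rounding down loses at most a factor of 2. *)
have bm : n%:R / (2 * m.+1%:R) <= b%:R :> R.
  rewrite ler_pdivrMr ?mulr_gt0 // -!natrM ler_nat.
  have := divn_eq n m.+1; have := ltn_pmod n (ltn0Sn m).
  have : (0 < b)%N by rewrite divn_gt0.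
  by rewrite -/b; nia.
have : b%:R / 2 * (b%:R * (n%:R * D)^-1 / 2) ^+ m <= \sum_w hit_prob p b w ^+ m.+1.
  apply: sum_hit_prob_ge => //.
  - by move=> w; apply: nbrw_law_ge0.
  - by rewrite invr_ge0 mulr_ge0 // ltW.
  - by move=> w; apply: nbrw_law_ge.
  move=> w; apply: (@le_trans _ _ (n%:R * n%:R^-1)); last by rewrite divff ?gt_eqF.
  by apply: ler_pM => //; [apply: nbrw_law_ge0|apply: nbrw_law_le].
set mu := \sum_w _ => mu_ge.
have K0 : 0 < 4 * m.+1%:R * D by rewrite !mulr_gt0.
have {}mu_ge : n%:R / (4 * m.+1%:R * D) ^+ m.+1 <= mu.
  apply: le_trans mu_ge; rewrite exprS invfM mulrA -exprVn.
  (* This factor holds even without [D]; including [D], which is at least 1, turns the bound into a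
     single power. *)
  have e1 : n%:R / (4 * m.+1%:R * D) <= b%:R / 2.
    apply: (@le_trans _ _ (n%:R / (2 * m.+1%:R) / 2)); last by rewrite ler_pM2r ?invr_gt0.
    rewrite (_ : n%:R / (2 * m.+1%:R) / 2 = n%:R / (4 * m.+1%:R)); last first.
      by field; rewrite gt_eqF.
    rewrite ler_pM2l // lef_pV2 ?posrE ?mulr_gt0 // -[leLHS]mulr1.
    by rewrite ler_pM2l // mulr_gt0.
  have e2 : (4 * m.+1%:R * D)^-1 <= b%:R * (n%:R * D)^-1 / 2.
    apply: (@le_trans _ _ (n%:R / (2 * m.+1%:R) * (n%:R * D)^-1 / 2)); last first.
      by rewrite ler_pM2r ?invr_gt0 // ler_pM2r // invr_gt0 mulr_gt0.
    rewrite le_eqVlt; apply/orP; left; apply/eqP; field.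
    by rewrite !gt_eqF.
  apply: ler_pM => //.
  - by rewrite ltW // divr_gt0.
  - by rewrite exprn_ge0 // invr_ge0 ltW.
  - by apply: lerXn2r; rewrite ?nnegrE ?(le_trans _ e2) // invr_ge0 ltW.
have l0 : 0 < n%:R / (4 * m.+1%:R * D) ^+ m.+1 by rewrite divr_gt0 // exprn_gt0.
have mu0 : 0 < mu by apply: lt_le_trans mu_ge.
apply: le_trans (alloc_prob_repeated_walk mu0 _); last by rewrite mulnC leq_divM.
by rewrite lerD2l lerN2 -[leRHS]invf_div lef_pV2.
Qed.

End AllocationLaw.

(** * Estimates on logarithms and on the choice of parameters *)

Lemma ln_nat_ge_two_thirds (R : realType) (d : nat) : (3 <= d)%N -> 2 / 3 <= ln (d%:R : R).
Proof.
move=> d3; apply: (@le_trans _ _ (ln (3 : R))); last first.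
  by rewrite ler_ln ?posrE ?ltr0n ?ler_nat // (leq_trans _ d3).
(* The bound ln(1 + x) <= x at x = -2/3 reads ln(1/3) <= -2/3. *)
have := @le_ln1Dx R (- (2 / 3)); rewrite (_ : 1 + - (2 / 3) = 3^-1 :> R); last by field.
by rewrite lnV ?posrE // => /(_ ltac:(lra)); lra.
Qed.

(** As 4m <= ln n <= d^r <= d^(l r), the base is at most d^(2 l r). Its m-th power is exp(2 l r m ln
    d), and the 8 in the choice of m makes this exponent at most (ln n) / 4. *)
Lemma repeated_walk_bound (R : realType) (n d l r m : nat) :
  (0 < n)%N -> (3 <= d)%N -> (0 < r)%N -> (32 <= l)%N ->
  ln (n%:R : R) <= d%:R ^+ r ->
  m%:R <= log_base (d%:R : R) n%:R / (8 * (l * r)%:R) ->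
  m%:R <= ln (n%:R : R) /\ (4 * m%:R * d%:R ^+ (l * r)) ^+ m <= n%:R `^ (4^-1) :> R.
Proof.
move=> n0 d3 r0 l32 lnd; rewrite /log_base.
have lnd3 := ln_nat_ge_two_thirds R d3.
set a := ln (n%:R : R) in lnd *; set e := ln (d%:R : R) in lnd3 *.
have lr32 : (32 <= l * r)%N by rewrite (leq_trans l32) // leq_pmulr.
have t32 : 32 <= (l * r)%:R :> R by rewrite (ler_nat R 32).
have r_t : (r <= l * r)%N by rewrite leq_pmull // (leq_trans _ l32).
rewrite -mulrA -invfM ler_pdivlMr; last by rewrite mulr_gt0; lra.
move: t32; set t := (l * r)%:R => t32 ma.
have m0 : 0 <= m%:R :> R by [].
have d0 : 0 < d%:R :> R by rewrite ltr0n (leq_trans _ d3).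
have te : 64 / 3 <= t * e.
  have : 32 * (2 / 3) <= t * e by apply: ler_pM => //; lra.
  by lra.
have m_le : 4 * m%:R <= a.
  apply: le_trans ma; rewrite (_ : e * (8 * t) = 8 * (t * e)); last by ring.
  by rewrite mulrC ler_wpM2l //; lra.
split; first by lra.
have K : 4 * m%:R * d%:R ^+ (l * r) <= d%:R ^+ (2 * (l * r)) :> R.
  rewrite mul2n -addnn exprD ler_pM ?exprn_ge0 // ?mulr_ge0 //.
  apply: le_trans m_le (le_trans lnd _); apply: ler_weXn2l => //.
  by rewrite ler1n (leq_trans _ d3).
apply: (@le_trans _ _ ((d%:R ^+ (2 * (l * r))) ^+ m)).
  by rewrite lerXn2r // nnegrE ?exprn_ge0 // !mulr_ge0 ?exprn_ge0.
rewrite -[d%:R](@lnK R) // -/e -[n%:R](@lnK R) ?posrE ?ltr0n // -/a -exprM.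
rewrite -expRM_natl -expRM ler_expR !natrM -/t.
rewrite -[(l%:R * r%:R)]natrM -/t; lra.
Qed.

(** In the first case the little-o with constant 1 gives ln n <= d. In the second, (d - 1)^r is at
    least (ln n)^2 by the choice of r. *)
Lemma r_G_large (R : realType) (G : nat -> sgraph) (d : nat -> nat) :
  (fun k => #|G k|) @ \oo --> \oo -> (forall k, (3 <= d k)%N) ->
  \forall k \near \oo, (0 < r_G R G d k)%N /\
    ln (#|G k|%:R : R) <= (d k)%:R ^+ r_G R G d k.
Proof.
move=> n_infty d3; rewrite /r_G; case: asboolP => [/eqoP/(_ 1 ltr01) H|_].
  near=> k; split => //; rewrite expr1.
  apply: le_trans (ler_norm _) _.
  have : `|ln (#|G k|%:R : R)| <= 1 * `|(d k)%:R : R| by near: k.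
  by rewrite mul1r (ger0_norm (ler0n _ _)).
have /cvgnyPge/(_ 9%N) n_large := n_infty.
near=> k.
(* As 9 = 3^2, this gives ln n >= 4/3 > 1, so ln ln n and the argument of the ceiling are
   positive. *)
have n9 : (9 <= #|G k|)%N by near: k.
set n := #|G k| in n9 *; set x := ln (n%:R : R).
have x1 : 1 < x.
  apply: (@lt_le_trans _ _ (ln (3 ^+ 2 : R))).
    by rewrite lnXn // mulr2n; have := @ln_nat_ge_two_thirds R 3 isT; lra.
  by rewrite ler_ln ?posrE ?exprn_gt0 ?ltr0n ?(leq_trans _ n9) // -natrX ler_nat.
set D := ((d k).-1%:R : R).
have D1 : 1 < D by rewrite ltr1n -ltnS prednK ?(leq_trans _ (d3 k)).
have lnD : 0 < ln D by rewrite ln_gt0.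
have lnx : 0 < ln x by rewrite ln_gt0.
set y := 2 * log_base D x.
have y0 : 0 < y by rewrite mulr_gt0 // divr_gt0.
have c0 : 0 < Num.ceil y by rewrite ltNge ceil_le0 -ltNge.
have absr : (`|Num.ceil y|%N%:R : R) = (Num.ceil y)%:~R.
  by rewrite natr_absz gtr0_norm.
split; first by rewrite absz_gt0 gt_eqF.
have yr : y <= `|Num.ceil y|%N%:R by rewrite absr ceil_ge.
move: yr; set r := `|_|%N => yr.
apply: (@le_trans _ _ (D ^+ r)); last first.
  by rewrite lerXn2r ?nnegrE // ler_nat leq_pred.
have x0 : 0 < x by lra.
have D0 : 0 < D by lra.
rewrite -ler_ln ?posrE ?exprn_gt0 // lnXn // -[leRHS]mulr_natl.
apply: (@le_trans _ _ (y * ln D)); last by rewrite ler_pM2r.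
by rewrite /y /log_base -mulrA divfK ?gt_eqF //; lra.
Unshelve. all: by end_near.
Qed.

(** Here [L] stands for log_d n and [q] for the maximum load. The bound 1 <= q absorbs the 1 lost in
    truncating to m, and 32 leaves room for replacing l + 1 by l. *)
Lemma scaled_log_le (F : realFieldType) (L r l m q : F) :
  0 < r -> 32 <= l -> 1 <= q -> m <= (l + 1) * q -> L / (8 * (l * r)) < m + 1 ->
  32^-1 * (L / (r * l ^+ 2)) <= q.
Proof.
move=> r0 l32 q1 mq.
have l0 : 0 < l by lra.
rewrite ltr_pdivrMr => [Lm|]; last by rewrite !mulr_gt0.
rewrite mulrA ler_pdivrMr; last by rewrite mulr_gt0 // exprn_gt0.
have lr0 : 0 < l * r by rewrite mulr_gt0.
rewrite (_ : q * _ = q * l * (l * r)); last by ring.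
have h : (m + 1) * (8 * (l * r)) <= (32 * (q * l)) * (l * r).
  rewrite mulrA ler_pM2r //.
  have : q * 32 <= q * l by rewrite ler_pM2l //; lra.
  by lra.
by lra.
Qed.

(** * The lower bound, for one graph and then asymptotically *)

Lemma max_load_lower_bound (R : realType) (G : sgraph) (d l r : nat) :
  regular G d -> (0 < #|G|)%N -> (3 <= d)%N -> (0 < r)%N -> (32 <= l)%N ->
  ln (#|G|%:R : R) <= d%:R ^+ r ->
  1 - #|G|%:R `^ (- (3 / 4)) <=
  alloc_prob R (fun o : outcome G l r =>
    (32^-1 : R) * (log_base d%:R #|G|%:R / (r%:R * l%:R ^+ 2)) <= (max_load o)%:R).
Proof.
move=> G_regular n1 d3 r0 l32 lnd.
set n := #|G|; set L := log_base _ _.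
have n_gt0 : 0 < n%:R :> R by rewrite ltr0n.
have L0 : 0 <= L.
  by rewrite divr_ge0 ?ln_ge0 ?ler1n // (leq_trans _ d3).
have lR : 32 <= l%:R :> R by rewrite (ler_nat R 32).
have rR : 0 < r%:R :> R by rewrite ltr0n.
pose x := L / (8 * (l * r)%:R).
have x0 : 0 <= x by rewrite divr_ge0.
have d1 : (1 < d)%N := ltnW d3.
pose m := Num.truncn x.
have /andP[mx xm] := truncn_itv x0; rewrite -/m in mx xm.
have to_load (o : outcome G l r) : (m <= l.+1 * max_load o)%N ->
    32^-1 * (L / (r%:R * l%:R ^+ 2)) <= (max_load o)%:R.
  move=> mo; apply: (@scaled_log_le _ _ _ _ m%:R) => //.
  - by rewrite ler1n max_load_gt0.
  - by rewrite natr1 -natrM ler_nat.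
  - by rewrite natr1 -natrM.
(* If m = 0 the target is met by any maximum load of at least 1, so the event has probability 1. *)
have [m0|m1] := posnP m.
  apply: (@le_trans _ _ (alloc_prob R (fun _ : outcome G l r => true))).
    by rewrite (alloc_probT R l r G_regular d1 n1) lerBlDr lerDl powR_ge0.
  by apply: le_alloc_prob => o _ _; apply: to_load; rewrite m0.
have [m_ln K] := repeated_walk_bound n1 d3 r0 l32 lnd mx.
have mn : (0 < m <= n)%N.
  by rewrite m1 -(ler_nat R) (le_trans m_ln) // ltW // ln_sublinear.
apply: (@le_trans _ _ (alloc_prob R (fun o : outcome G l r =>
  (m <= l.+1 * max_load o)%N))); last first.
  by apply: le_alloc_prob => o _; apply: to_load.
apply: le_trans (alloc_prob_max_load R l r G_regular d1 n1 mn).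
(* The failure probability is at most n^(1/4) / n = n^(-3/4). *)
rewrite lerD2l lerN2 ler_pdivrMr //; apply: le_trans K _.
rewrite -[X in _ * X]powRr1 // -powRD; last by apply/implyP => _; rewrite gt_eqF.
by rewrite (_ : - (3 / 4) + 1 = 4^-1) //; field.
Qed.

Theorem mainTheorem3 (R : realType) (G : nat -> sgraph) (d l : nat -> nat)
  (n_infty : (fun k => #|G k|) @ \oo --> \oo)
  (d_ge3 : forall k, (3 <= d k)%N)
  (G_regular : forall k, regular (G k) (d k))
  (girth_omega_l : (fun k => (l k)%:R : R) =o_\oo (fun k => (girth (G k))%:R : R))
  (l_lower : forall k, (32 * r_G R G d k <= l k)%N)
  (l_upper : (fun k => (l k)%:R : R) =O_\oo (gamma_G R G d)) :
  exists c a : R, 0 < c /\ 0 < a /\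
    \forall k \near \oo,
      1 - #|G k|%:R `^ (- a) <=
      alloc_prob R (fun o : outcome (G k) (l k) (r_G R G d k) =>
        c * (log_base (d k)%:R #|G k|%:R / ((r_G R G d k)%:R * (l k)%:R ^+ 2))
          <= (max_load o)%:R).
Proof.
exists (32^-1), (3 / 4); split; first by rewrite invr_gt0.
split; first by rewrite divr_gt0.
have /cvgnyPge/(_ 1%N) n_large := n_infty.
have r_large := r_G_large R n_infty d_ge3.
near=> k.
have [r0 lnd] : (0 < r_G R G d k)%N /\
    ln (#|G k|%:R : R) <= (d k)%:R ^+ r_G R G d k by near: k.
apply: max_load_lower_bound => //; first by near: k.
(* Since r is positive, l >= 32 r gives l >= 32. *)
by apply: leq_trans (l_lower k); rewrite leq_pmulr.
Unshelve. all: by end_near.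
Qed.
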